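(* Let $\mathcal X$, $a(\cdot,\cdot)$, $(\mathcal X_\ell)_{\ell\in\mathbb N_0}$, $u$, $u_\ell$ be as in the context. Suppose there exist a Riesz basis $(w_n)_{n\in\mathbb N}$ of $\mathcal X$ and a constant $C>0$ such that all $x=\sum_{n\in\mathbb N}\lambda_nw_n\in\mathcal X$ satisfy $$C^{-1}\|x\|_{\mathcal X}^2\le\sum_{n\in\mathbb N}\lambda_n^2\le C\|x\|_{\mathcal X}^2,$$ and that $\mathcal X_\ell={\rm span}\{w_n:n\in\{1,\dots,N_\ell\}\}$ for some $N_\ell\in\mathbb N$ with $N_\ell<N_{\ell+1}$ for all $\ell\in\mathbb N_0$; this defines a block structure (blocks of indices $\{1,\dots,N_0\}$, $\{N_0+1,\dots,N_1\}$, $\{N_1+1,\dots,N_2\}$, …). Let $M\in\mathbb R^{\mathbb N\times\mathbb N}$, $M_{ij}:=a(w_j,w_i)$. Assume that for some $\varepsilon>0$ there exists $M^\varepsilon\in\mathbb R^{\mathbb N\times\mathbb N}$ with $\|M-M^\varepsilon\|_2\le\varepsilon$. If $M$ and $M^\varepsilon$ both satisfy the matrix inf-sup condition (with constant $C_{\rm inf-sup}$) with respect to this block structure, and $M^\varepsilon=LU$ has a block-$LU$-factorization such that $U,U^{-1}\colon\ell_2\to\ell_2$ are bounded operators, then general quasi-orthogonality holds: there is $C_{\rm qo}>0$ such that for all $\ell,N\in\mathbb N_0$ $$\sum_{k=\ell}^{\ell+N}\Big(\|u_{k+1}-u_k\|_{\mathcal X}^2-C_{\rm qo}\,\varepsilon\,\|u-u_k\|_{\mathcal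 X}^2\Big)\le C_{\rm qo}\|u-u_\ell\|_{\mathcal X}^2 .$$ The constant $C_{\rm qo}$ depends only on the basis $(w_n)$, on $a$, $C_{\rm inf-sup}$, $C$, and on the norms of $U$ and $U^{-1}$.
   Context: **Setting.** $\mathcal X$ is a real Hilbert space, $a\colon\mathcal X\times\mathcal X\to\mathbb R$ a bounded bilinear form, $\mathcal X_0\subseteq\mathcal X_1\subseteq\dots\subseteq\mathcal X$ nested finite-dimensional subspaces, with the inf-sup conditions $\inf_{x\in\mathcal X\setminus\{0\}}\sup_{v\in\mathcal X\setminus\{0\}}\frac{a(x,v)}{\|x\|_{\mathcal X}\|v\|_{\mathcal X}}>0$ and $\inf_{\ell\in\mathbb N_0}\inf_{x\in\mathcal X_\ell\setminus\{0\}}\sup_{v\in\mathcal X_\ell\setminus\{0\}}\frac{a(x,v)}{\|x\|_{\mathcal X}\|v\|_{\mathcal X}}>0$. For $f\in\mathcal X^\star$, $u\in\mathcal X$ and $u_\ell\in\mathcal X_\ell$ are the unique solutions of $a(u,v)=\langle f,v\rangle$ for all $v\in\mathcal X$ and $a(u_\ell,v)=\langle f,v\rangle$ for all $v\in\mathcal X_\ell$. **Infinite matrices.** $\|\cdot\|_2$ is the operator (spectral) norm of (infinite) matrices on $\ell_2$. A block structure is a strictly increasing sequence $1=n_1<n_2<\dots$ of natural numbers; $M(i,j):=M|_{\{n_i,\dots,n_{i+1}-1\}\times\{n_j,\dots,n_{j+1}-1\}}$ denotes the matrix blocks, and $M[k]\in\mathbb R^{(n_{k+1}-1)\times(n_{k+1}-1)}$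 the restriction of $M$ to the first $k\times k$ blocks. (Here $n_{k+1}=N_{k-1}+1$ for $k\ge1$.) Matrix inf-sup condition: all $M[k]$ are invertible and $\sup_{k\in\mathbb N}\|(M[k])^{-1}\|_2=C_{\rm inf-sup}<\infty$. A block-$LU$-factorization of $M$ is $M=LU$ with infinite matrices $L,U$ such that $L(i,i)=I$ for all $i$, and $L(i,j)=0=U(j,i)$ for all $i<j$. *)

(* Defs.v *)
From mathcomp Require Import all_boot all_order all_algebra.
From mathcomp Require Import all_classical all_reals all_analysis.

Set Implicit Arguments.
Unset Strict Implicit.
Unset Printing Implicit Defensive.
Import Order.TTheory GRing.Theory Num.Theory.
Import numFieldNormedType.Exports.

#[global] Open Scope classical_set_scope.
#[global] Open Scope ring_scope.

(* Bases, l2 sequences and infinite matrices are indexed from 0, so that n : nat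
   stands for the n+1-st basis vector, coordinate, row or column. *)

Section HilbertSpace.
Context {R : realType} {V : completeNormedModType R}.

(* The norm of V is the one induced by the inner product; with the
   completeness of V this makes (V, ip) a real Hilbert space. *)
Definition is_hilbert (ip : {dot V for idfun}) : Prop :=
  forall x, `|x| ^+ 2 = ip x x.

Definition bounded_form (a : {biscalar V}) : Prop :=
  exists K : R, forall x v, `|a x v| <= K * `|x| * `|v|.

Definition infsup (a : {biscalar V}) (Y : set V) : \bar R :=
  ereal_inf [set ereal_sup [set (a x v / (`|x| * `|v|))%:E | v in Y `\ 0]
            | x in Y `\ 0].

Definition expansion (w : nat -> V) (c : nat -> R) (x : V) : Prop :=
  series (fun n => c n *: w n) @ \oo --> x.

Definition orthonormal_basis (ip : {dot V for idfun}) (e : nat -> V) : Prop :=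
  (forall m n, ip (e m) (e n) = (m == n)%:R) /\
  (forall x, expansion e (fun n => ip x (e n)) x).

(* image of an orthonormal basis under a bounded linear isomorphism *)
Definition riesz_basis (ip : {dot V for idfun}) (w : nat -> V) : Prop :=
  exists e : nat -> V, exists T S : {linear V -> V},
    [/\ orthonormal_basis ip e,
        continuous T, continuous S,
        cancel T S /\ cancel S T
      & forall n, w n = T (e n)].

Definition lin_span (w : nat -> V) (n : nat) : set V :=
  [set x | exists c : 'I_n -> R, x = \sum_(i < n) c i *: w i].

Definition galerkin_solution (a : {biscalar V}) (f : {scalar V})
    (Y : set V) (u : V) : Prop :=
  Y u /\ forall v, Y v -> a u v = f v.

End HilbertSpace.

Section InfiniteMatrices.
Context {R : realType}.

Definition infmx : Type := nat -> nat -> R.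

Definition infmx_sub (A B : infmx) : infmx := fun i j => A i j - B i j.

Definition l2norm (x : nat -> R) : \bar R :=
  Lnorm (@counting nat R) 2%:E (EFin \o x).

Definition l2 : set (nat -> R) := [set x | (l2norm x < +oo)%E].

Definition infmx_app (A : infmx) (x : nat -> R) : nat -> R :=
  fun i => limn (series (fun k => A i k * x k)).

(* Operator norm on l2, as the least admissible bound; it is +oo when A does
   not define a bounded operator l2 -> l2, in particular when one of the row
   series diverges for some x in l2. *)
Definition infmx_norm (A : infmx) : \bar R :=
  ereal_inf [set c%:E | c in [set c : R | 0 <= c /\
    forall x, l2 x ->
      (forall i, cvgn (series (fun k => A i k * x k))) /\
      (l2norm (infmx_app A x) <= c%:E * l2norm x)%E]].

Definition infmx_inverse (A B : infmx) : Prop :=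
  forall x, l2 x ->
    infmx_app B (infmx_app A x) = x /\ infmx_app A (infmx_app B x) = x.

Definition euclid_norm n (x : 'cV[R]_n) : R :=
  Num.sqrt (\sum_(i < n) x i 0 ^+ 2).

(* not the norm carried by 'M[R]_n in the library, which is the max norm *)
Definition spectral_norm n (A : 'M[R]_n) : \bar R :=
  ereal_inf [set c%:E | c in [set c : R | 0 <= c /\
    forall x : 'cV[R]_n, euclid_norm (A *m x) <= c * euclid_norm x]].

(* A block structure is given by the sequence b of the (0-based) first indices
   of its blocks, b k = n_(k+1) - 1; this is the one with blocks {0..N_0-1},
   {N_0..N_1-1}, {N_1..N_2-1}, etc. *)
Definition block_start (N : nat -> nat) (k : nat) : nat :=
  if k is k'.+1 then N k' else 0%N.

Definition mxblk (b : nat -> nat) (A : infmx) (i j : nat) :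
    'M[R]_(b i.+1 - b i, b j.+1 - b j) :=
  \matrix_(p, q) A (b i + p)%N (b j + q)%N.

(* the restriction of A to its first k x k blocks *)
Definition mxlead (b : nat -> nat) (A : infmx) (k : nat) : 'M[R]_(b k) :=
  \matrix_(p, q) A p q.

Definition mx_infsup (b : nat -> nat) (A : infmx) (C : R) : Prop :=
  (forall k, (0 < k)%N -> mxlead b A k \in unitmx) /\
  (ereal_sup [set spectral_norm (invmx (mxlead b A k)) | k in [set k | (0 < k)%N]]
     <= C%:E)%E.

Definition block_LU (b : nat -> nat) (A L U : infmx) : Prop :=
  [/\ forall i j, series (fun k => L i k * U k j) @ \oo --> A i j,
      forall i, mxblk b L i i = 1%:M
    & forall i j, (i < j)%N -> mxblk b L i j = 0 /\ mxblk b U j i = 0].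

End InfiniteMatrices.
Arguments infmx : clear implicits.

Definition gram (R : realType) (V : completeNormedModType R)
    (a : {biscalar V}) (w : nat -> V) : infmx R :=
  fun i j => a (w j) (w i).

(* Main.v *)
Require Import Defs.
From mathcomp Require Import all_boot all_order all_algebra.
From mathcomp Require Import all_classical all_reals all_analysis.
From mathcomp Require Import lra ring.
Import Order.TTheory GRing.Theory Num.Theory.
Import numFieldNormedType.Exports.

(** The increments of the Galerkin coefficient vectors are [z_k = lam_(k+1) - lam_k].
  If [eps = 0], then [L U z_k] vanishes in the first [N k] entries, and so does
  [U z_k] because [L] is block lower triangular with invertible leading parts.
  Since [U] is block upper triangular, [U z_k] is then exactly the block
  [N k <= i < N k.+1] of [U (lam_m - lam_l)], where [m = l + n + 1].
  The [U z_k] are thus orthogonal and the sum of their squared norms is at most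
  [|U (lam_m - lam_l)|^2], which quasi-optimality bounds by [|u - u_l|^2].
  For general [eps], the leading part of [L^-1] is [U] times the inverse of the
  leading part of [Meps]; hence the entries of [U z_k] and [U (lam_m - lam_(k+1))]
  that vanished before are now of size [eps * |u - u_k|], which adds
  [eps^2 * |u - u_k|^2] to each summand. For [eps > 1] quasi-optimality alone
  suffices. The vector [lam_m] replaces the coefficients of [u], so that all
  vectors have finite support. *)

(** * Finitely supported sequences and what the operator norms say about them *)

Section FiniteSections.
Set Implicit Arguments.
Unset Strict Implicit.
Context {R : realType}.
Implicit Types (A : infmx R) (x y : nat -> R) (c : R).

Definition sqsum (n : nat) x : R := \sum_(i < n) x i ^+ 2.

(** Only the columns are truncated and the rows stay infinite; for [x] supported below [n] this is
    the full product [A x]. *)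
Definition appn A (n : nat) x : nat -> R := fun i => \sum_(k < n) A i k * x k.

Definition suppn (n : nat) x : Prop := forall k, (n <= k)%N -> x k = 0.

Lemma sqsum_ge0 n x : 0 <= sqsum n x.
Proof. by apply: sumr_ge0 => i _; exact: sqr_ge0. Qed.

Lemma sum_widen (V : zmodType) n m (u : nat -> V) : (n <= m)%N ->
  (forall k, (n <= k)%N -> u k = 0) -> \sum_(i < m) u i = \sum_(i < n) u i.
Proof.
move=> nm u0; rewrite -!(big_mkord xpredT u) (big_cat_nat (leq0n n) nm) /=.
rewrite [X in _ + X]big1_seq ?addr0// => i /andP[_].
by rewrite mem_index_iota => /andP[/u0].
Qed.

Lemma sqsum_supp n m x : (n <= m)%N -> suppn n x -> sqsum m x = sqsum n x.
Proof.
move=> nm x0; apply: (@sum_widen _ _ _ (fun k => x k ^+ 2)) => // k /x0->.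
by rewrite expr0n.
Qed.

Lemma appn_supp A n m x : (n <= m)%N -> suppn n x -> appn A m x = appn A n x.
Proof.
move=> nm x0; apply/funext => i.
by apply: (@sum_widen _ _ _ (fun k => A i k * x k)) => // k /x0->; rewrite mulr0.
Qed.

Lemma cvg_series_finite (V : normedModType R) n (u : nat -> V) :
  (forall k, (n <= k)%N -> u k = 0) -> series u @ \oo --> \sum_(k < n) u k.
Proof.
move=> u0; apply: cvg_near_cst; exists n => // m /= nm.
by rewrite seriesEord/=; exact: sum_widen.
Qed.

Lemma infmx_app_finite A n x : suppn n x -> infmx_app A x = appn A n x.
Proof.
move=> x0; apply/funext => i; apply/cvg_lim => //.
by apply: cvg_series_finite => k /x0->; rewrite mulr0.
Qed.

Lemma l2normE x : l2norm x = ((\sum_(0 <= k <oo) (x k ^+ 2)%:E) `^ 2^-1)%E.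
Proof.
rewrite /l2norm Lnorm_counting//; congr ((_ `^ _)%E); apply: eq_eseriesr => k _ /=.
by rewrite powR_mulrn// real_normK// num_real.
Qed.

Lemma sqsum_nneseries n x : suppn n x ->
  (\sum_(0 <= k <oo) (x k ^+ 2)%:E = (sqsum n x)%:E)%E.
Proof.
move=> x0; rewrite (nneseries_split 0 n)/= => [|k _]; last by rewrite lee_fin sqr_ge0.
rewrite add0n eseries0 ?adde0 => [|k nk _]; last by rewrite x0// expr0n.
by rewrite big_mkord sumEFin.
Qed.

Lemma l2norm_finite n x : suppn n x -> l2norm x = (Num.sqrt (sqsum n x))%:E.
Proof.
by move=> x0; rewrite l2normE (sqsum_nneseries x0) poweR_EFin powR12_sqrt// sqsum_ge0.
Qed.

Lemma l2norm_ge_sqsum n x : ((Num.sqrt (sqsum n x))%:E <= l2norm x)%E.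
Proof.
have ge0 : (0 <= \sum_(0 <= k <oo) (x k ^+ 2)%:E)%E.
  by apply: nneseries_ge0 => k _ _; rewrite lee_fin sqr_ge0.
rewrite l2normE -powR12_sqrt ?sqsum_ge0// -poweR_EFin.
apply: gt0_ler_poweR; rewrite ?in_itv/= ?lee_fin ?sqsum_ge0 ?leey ?andbT//.
apply: le_trans (nneseries_lim_ge n _) => [|k _ _]; last by rewrite lee_fin sqr_ge0.
by rewrite big_mkord sumEFin.
Qed.

Lemma l2_finite n x : suppn n x -> l2 x.
Proof. by move=> x0; rewrite /l2/= (l2norm_finite x0) ltry. Qed.

Lemma infimum_bound (P : R -> Prop) c :
  (ereal_inf [set d%:E | d in P] <= c%:E)%E ->
  forall e, 0 < e -> exists2 d, P d & d < c + e.
Proof.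
move=> le e e0.
have : (ereal_inf [set d%:E | d in P] < (c + e)%:E)%E.
  by apply: le_lt_trans le _; rewrite lte_fin ltrDl.
by move=> /ereal_inf_lt[_ [d Pd <-]]; rewrite lte_fin; exists d.
Qed.

(** Both [infmx_norm] and [spectral_norm] are infima of admissible constants; letting these tend to
    the infimum makes any upper bound [c] of it usable for a fixed vector. *)
Lemma bound_attained (P : R -> Prop) c a b : 0 <= a -> 0 <= b ->
  (forall d, P d -> 0 <= d /\ a <= d * b) ->
  (ereal_inf [set d%:E | d in P] <= c%:E)%E -> 0 <= c /\ a <= c * b.
Proof.
move=> a0 b0 Pab /infimum_bound Pc.
split; apply/ler_addgt0Pr => e e0.
  by have [d /Pab[d0 _] /ltW] := Pc _ e0; exact: le_trans.
(* The divisor is [1 + b] because [b] may be zero. *)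
have e'0 : 0 < e / (1 + b) by rewrite divr_gt0// ltr_pwDl.
have [d /Pab[_ /le_trans ad] dc] := Pc _ e'0; apply: ad.
apply: le_trans (ler_wpM2r b0 (ltW dc)) _.
rewrite mulrDl lerD2l mulrAC ler_pdivrMr ?ltr_pwDl// ler_wpM2l ?(ltW e0)//.
by rewrite lerDr.
Qed.

Lemma le_of_sqrt a b c : 0 <= b -> 0 <= a -> 0 <= c ->
  Num.sqrt a <= c * Num.sqrt b -> a <= c ^+ 2 * b.
Proof.
move=> b0 a0 c0 h; rewrite -(sqr_sqrtr a0) -[in X in _ <= X](sqr_sqrtr b0) -exprMn.
by rewrite ler_sqr// nnegrE ?mulr_ge0// sqrtr_ge0.
Qed.

(** The image of a finitely supported vector may have infinite support, hence the cut at an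
    arbitrary [m]. *)
Lemma infmx_norm_finite A c n m x : (infmx_norm A <= c%:E)%E -> suppn n x ->
  sqsum m (appn A n x) <= c ^+ 2 * sqsum n x.
Proof.
move=> Ac x0.
have [||d [d0 /(_ _ (l2_finite x0))[_]]|c0 le] := bound_attained
    (a := Num.sqrt (sqsum m (appn A n x))) (b := Num.sqrt (sqsum n x)) _ _ _ Ac;
  rewrite ?sqrtr_ge0//.
  rewrite (l2norm_finite x0) (infmx_app_finite A x0) => le; split=> //.
  by rewrite -lee_fin EFinM; apply: le_trans le; exact: l2norm_ge_sqsum.
by apply: le_of_sqrt => //; exact: sqsum_ge0.
Qed.

(** The bound for [B] is applied to [A x], whose finite support keeps the argument within finite
    sums. *)
Lemma infmx_inverse_finite A B c n m x :
  infmx_inverse A B -> (infmx_norm B <= c%:E)%E ->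
  suppn n x -> suppn m (appn A n x) ->
  sqsum n x <= c ^+ 2 * sqsum m (appn A n x).
Proof.
move=> AB Bc x0 Ax0.
have [BAx _] := AB _ (l2_finite x0).
rewrite (infmx_app_finite A x0) (infmx_app_finite B Ax0) in BAx.
by rewrite -[in X in X <= _]BAx; exact: infmx_norm_finite.
Qed.

Lemma mx_infsup_lead b A c k x : mx_infsup b A c -> (0 < k)%N ->
  sqsum (b k) x <= c ^+ 2 * sqsum (b k) (appn A (b k) x).
Proof.
move=> [Aunit Ac] k0.
have {}Ac : (spectral_norm (invmx (mxlead b A k)) <= c%:E)%E.
  by apply: le_trans Ac; apply: ereal_sup_ubound; exists k.
pose X : 'cV[R]_(b k) := \col_i x i.
have normE (z : nat -> R) : euclid_norm (\col_(i < b k) z i) = Num.sqrt (sqsum (b k) z).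
  by congr Num.sqrt; apply: eq_bigr => i _; rewrite mxE.
have appE : mxlead b A k *m X = \col_i appn A (b k) x i.
  by apply/matrixP => i j; rewrite !mxE; apply: eq_bigr => q _; rewrite !mxE.
have [||d [d0 /(_ (mxlead b A k *m X))]|c0 le] := bound_attained
    (a := Num.sqrt (sqsum (b k) x))
    (b := Num.sqrt (sqsum (b k) (appn A (b k) x))) _ _ _ Ac; rewrite ?sqrtr_ge0//.
  by rewrite mulKmx ?Aunit// appE !normE.
by apply: le_of_sqrt => //; exact: sqsum_ge0.
Qed.

End FiniteSections.

(** * Block triangular factors, read entrywise and on leading sections *)

Section Blocks.
Context {R : realType}.
Set Implicit Arguments.
Unset Strict Implicit.
Implicit Types (A L U : infmx R) (x y : nat -> R) (c : R).

Lemma sqsumB n x y : sqsum n (x \- y) <= 2 * (sqsum n x + sqsum n y).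
Proof.
rewrite /sqsum -big_split mulr_sumr/=; apply: ler_sum => i _.
by have := sqr_ge0 (x i + y i); nra.
Qed.

Lemma appnB A n x y : appn A n (x \- y) = appn A n x \- appn A n y.
Proof.
by apply/funext => i; rewrite /appn /= -sumrB; apply: eq_bigr => k _; rewrite mulrBr.
Qed.

Lemma suppnB n x y : suppn n x -> suppn n y -> suppn n (x \- y).
Proof. by move=> x0 y0 k nk /=; rewrite x0// y0// subr0. Qed.

Lemma suppn_extension n (c : 'I_n -> R) :
  exists2 x, suppn n x & forall i : 'I_n, x i = c i.
Proof.
exists (fun k => oapp c 0 (insub k)) => [k nk|i]; last by rewrite valK.
by rewrite insubF// ltnNge nk.
Qed.

Context (b : nat -> nat) (b0 : b 0%N = 0%N) (b_lt : forall k, (b k < b k.+1)%N).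

Lemma block_index i : exists p, (b p <= i < b p.+1)%N.
Proof.
elim: i => [|i [p /andP[pi ip]]]; first by exists 0%N; have := b_lt 0; rewrite b0.
have [le|lt] := leqP (b p.+1) i.+1; last by exists p; rewrite lt (leq_trans pi).
by exists p.+1; rewrite le/=; apply: leq_trans (b_lt p.+1); rewrite ltnS.
Qed.

(** Translates the blockwise zero pattern of [L] and [U] into an entrywise one: since [b] is
    increasing, the blocks of [i] and [j] satisfy [p < k <= q]. *)
Lemma block_separated i j k : (i < b k <= j)%N -> exists p q,
  [/\ (p < q)%N, (b p <= i < b p.+1)%N & (b q <= j < b q.+1)%N].
Proof.
have b_homo : {homo b : p q / (p <= q)%N}.
  by apply: homo_leq leq_trans _ => // p; exact: ltnW.
have b_inv p q : (b p < b q)%N -> (p < q)%N.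
  by apply: contraTT; rewrite -!leqNgt; exact: b_homo.
move=> /andP[ik kj]; have [p pP] := block_index i; have [q qP] := block_index j.
exists p, q; split=> //; apply: (@leq_trans k).
  by apply: b_inv; apply: leq_ltn_trans ik; case/andP: pP.
by rewrite -ltnS; apply: b_inv; apply: leq_ltn_trans kj _; case/andP: qP.
Qed.

Lemma mxblk_eq0 A p q i j : mxblk b A p q = 0 ->
  (b p <= i < b p.+1)%N -> (b q <= j < b q.+1)%N -> A i j = 0.
Proof.
move=> A0 /andP[pi ip] /andP[qj jq].
have lt_i : (i - b p < b p.+1 - b p)%N by rewrite ltn_sub2r.
have lt_j : (j - b q < b q.+1 - b q)%N by rewrite ltn_sub2r.
by move/matrixP/(_ (Ordinal lt_i) (Ordinal lt_j)): A0; rewrite !mxE/= !subnKC.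
Qed.

Context (A L U : infmx R) (LU : block_LU b A L U).

Lemma block_lower k i j : (i < b k <= j)%N -> L i j = 0.
Proof.
case: LU => _ _ LU0 /block_separated[p [q [pq pi qj]]].
exact: mxblk_eq0 (LU0 _ _ pq).1 pi qj.
Qed.

Lemma block_upper k i j : (j < b k <= i)%N -> U i j = 0.
Proof.
case: LU => _ _ LU0 /block_separated[p [q [pq pj qi]]].
exact: mxblk_eq0 (LU0 _ _ pq).2 qi pj.
Qed.

Lemma suppn_upper k x : suppn (b k) (appn U (b k) x).
Proof.
move=> i ki; rewrite /appn big1// => j _.
by rewrite (@block_upper k) ?mul0r// ltn_ord.
Qed.

(** In row [i] the factor [L] vanishes from column [b k] on, so the series for the product
    terminates whatever the column [j]. *)
Lemma block_LU_sum k i j : (i < b k)%N -> A i j = \sum_(q < b k) L i q * U q j.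
Proof.
move=> ik; case: LU => cvgA _ _; apply: cvg_unique (cvgA i j) _ => //.
apply: cvg_series_finite => q kq.
by rewrite (@block_lower k) ?mul0r// ik.
Qed.

(** The first [b k] entries of [A x] see only the first [b k] entries of [U x], even if [x] reaches
    further ([m > b k]). *)
Lemma appn_block_LU k m x i : (i < b k)%N ->
  appn A m x i = appn L (b k) (appn U m x) i.
Proof.
move=> ik; rewrite /appn.
under eq_bigr do rewrite (block_LU_sum _ ik) mulr_suml.
rewrite exchange_big; apply: eq_bigr => q _ /=.
by rewrite mulr_sumr; apply: eq_bigr => j _; rewrite mulrA.
Qed.

Context (Cis cU : R) (A_infsup : mx_infsup b A Cis)
  (U_norm : (infmx_norm U <= cU%:E)%E).

(* [L] restricted to the leading blocks is inverted by [U] times the inverse of [A] *)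
Lemma block_lower_infsup k y : (0 < k)%N ->
  sqsum (b k) y <= cU ^+ 2 * Cis ^+ 2 * sqsum (b k) (appn L (b k) y).
Proof.
move=> k0; have leadLU : mxlead b A k = mxlead b L k *m mxlead b U k.
  apply/matrixP => i j; rewrite !mxE (block_LU_sum _ (ltn_ord i)).
  by apply: eq_bigr => q _; rewrite !mxE.
have /andP[_ Uunit] : (mxlead b L k \in unitmx) && (mxlead b U k \in unitmx).
  by rewrite -unitmx_mul -leadLU A_infsup.1.
(* With this preimage of [y] under [U], [L y] becomes [A x] on the leading blocks, so the bounds for
   [U] and for the inverse of [A] compose. *)
pose X := invmx (mxlead b U k) *m \col_i y i.
have [x x0 xX] := suppn_extension (fun i => X i 0).
have Ux (i : 'I_(b k)) : appn U (b k) x i = y i.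
  have /matrixP/(_ i 0) : mxlead b U k *m X = \col_i y i by rewrite mulKVmx.
  by rewrite mxE [RHS]mxE => <-; apply: eq_bigr => q _; rewrite xX [mxlead _ _ _ _ _]mxE.
have -> : sqsum (b k) y = sqsum (b k) (appn U (b k) x).
  by apply: eq_bigr => i _; rewrite Ux.
have -> : sqsum (b k) (appn L (b k) y) = sqsum (b k) (appn A (b k) x).
  apply: eq_bigr => i _; rewrite (appn_block_LU _ _ (ltn_ord i)); congr (_ ^+ 2).
  by apply: eq_bigr => q _; rewrite Ux.
apply: le_trans (infmx_norm_finite _ U_norm x0) _.
by rewrite -mulrA ler_wpM2l ?sqr_ge0// mx_infsup_lead.
Qed.

(** On the first [b k] rows [M x = 0], so there [L (U x) = A x = -(M - A) x] has size at most
    [eps * |x|]; [block_lower_infsup] then removes [L]. *)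
Lemma upper_perturbation M eps k m x : (0 < k)%N -> suppn m x ->
  (infmx_norm (infmx_sub M A) <= eps%:E)%E ->
  (forall i, (i < b k)%N -> appn M m x i = 0) ->
  sqsum (b k) (appn U m x) <= cU ^+ 2 * Cis ^+ 2 * eps ^+ 2 * sqsum m x.
Proof.
move=> k0 x0 MA Mx0; apply: le_trans (block_lower_infsup _ k0) _.
rewrite -[X in _ <= X]mulrA -!exprMn ler_wpM2l ?sqr_ge0//.
suff -> : sqsum (b k) (appn L (b k) (appn U m x)) =
    sqsum (b k) (appn (infmx_sub M A) m x).
  exact: infmx_norm_finite.
apply: eq_bigr => i _; rewrite -appn_block_LU// -sqrrN; congr (_ ^+ 2).
rewrite -[LHS]add0r -[X in X - _](Mx0 _ (ltn_ord i)) /appn -sumrB.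
by apply: eq_bigr => q _; rewrite mulrBl.
Qed.

End Blocks.

(** * Images under [U] of the differences of Galerkin coefficient vectors *)

Section UpperIncrements.
Context {R : realType}.
Set Implicit Arguments.
Unset Strict Implicit.
Context (N : nat -> nat) (hN0 : (0 < N 0%N)%N) (hN : forall k, (N k < N k.+1)%N).
Context (M A L U Uinv : infmx R) (Cis cU cUinv eps : R).
Context (A_infsup : mx_infsup (block_start N) A Cis)
  (MA : (infmx_norm (infmx_sub M A) <= eps%:E)%E)
  (LU : block_LU (block_start N) A L U)
  (UUinv : infmx_inverse U Uinv)
  (U_norm : (infmx_norm U <= cU%:E)%E)
  (Uinv_norm : (infmx_norm Uinv <= cUinv%:E)%E).
Context (lam : nat -> nat -> R) (lam_supp : forall k, suppn (N k) (lam k)).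
Context (lam_orth : forall k k' m i, (k <= k')%N -> (k' <= m)%N -> (i < N k)%N ->
  appn M (N m) (lam k' \- lam k) i = 0).

Let z k := lam k.+1 \- lam k.
Let K := cU ^+ 2 * Cis ^+ 2 * eps ^+ 2.

Lemma leN k k' : (k <= k')%N -> (N k <= N k')%N.
Proof. by move: k k'; apply: homo_leq leq_trans _ => // p; exact: ltnW. Qed.

Let b_lt k : (block_start N k < block_start N k.+1)%N.
Proof. by case: k. Qed.

Lemma lam_suppn k m : (k <= m)%N -> suppn (N m) (lam k).
Proof. by move=> /leN km i /(leq_trans km); exact: lam_supp. Qed.

(** The index shifts by one here and below because [block_start N k.+1] is [N k]. *)
Let upper_suppn k x : suppn (N k) (appn U (N k) x).
Proof. exact: (@suppn_upper _ _ _ b_lt _ _ _ LU k.+1). Qed.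

(** Galerkin orthogonality provides the zero rows that [upper_perturbation] asks for. *)
Lemma galerkin_upper k k' m : (k <= k')%N -> (k' <= m)%N ->
  sqsum (N k) (appn U (N m) (lam k' \- lam k)) <= K * sqsum (N m) (lam k' \- lam k).
Proof.
move=> kk' k'm.
apply: (@upper_perturbation _ _ _ b_lt _ _ _ LU _ _ A_infsup U_norm M _ k.+1) => //.
  by apply: suppnB; apply: lam_suppn; rewrite // (leq_trans kk').
by move=> i; exact: lam_orth.
Qed.

(* Modulo the perturbation [U z_k] lives in the [k+1]-st block, where it agrees
   with [U (lam_m - lam_l)]. *)
Lemma increment_bound l k m : (l <= k)%N -> (k < m)%N ->
  sqsum (N k.+1) (z k) <= cUinv ^+ 2 *
    (K * sqsum (N k.+1) (z k) + 2 * K * sqsum (N m) (lam m \- lam k.+1) +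
     2 * \sum_(N k <= i < N k.+1) appn U (N m) (lam m \- lam l) i ^+ 2).
Proof.
move=> lk km; have kk1 := leN (leqnSn k); have k1m := leN km.
have supp_z : suppn (N k.+1) (z k) by apply: suppnB => //; exact: lam_suppn.
apply: (le_trans (infmx_inverse_finite UUinv Uinv_norm supp_z (@upper_suppn k.+1 _))).
rewrite ler_wpM2l ?sqr_ge0//= {1}/sqsum.
rewrite -(big_mkord xpredT (fun i => appn U (N k.+1) (z k) i ^+ 2)).
(* Entries before [N k] are pure perturbation; the remaining ones form a single block. *)
rewrite (big_cat_nat (leq0n _) kk1)/= big_mkord -addrA; apply: lerD.
  exact: (galerkin_upper (leqnSn k)).
apply: (@le_trans _ _ (2 * (\sum_(N k <= i < N k.+1) appn U (N m) (lam m \- lam k.+1) i ^+ 2 +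
  \sum_(N k <= i < N k.+1) appn U (N m) (lam m \- lam l) i ^+ 2))).
  rewrite -big_split mulr_sumr/= !big_nat; apply: ler_sum => i /andP[ki _].
  rewrite -(appn_supp _ k1m supp_z).
  (* Since [lam k] and [lam l] are supported below [N k], so is the image of their difference under
     [U]. On the block this leaves [U z_k = U (lam_m - lam_l) - U (lam_m - lam_(k+1))]. *)
  have Ux0 : appn U (N m) (lam k \- lam l) i = 0.
    rewrite (@appn_supp _ _ (N k)) ?leN 1?ltnW//; last first.
      by apply: suppnB => //; exact: lam_suppn.
    exact: upper_suppn.
  have : appn U (N m) (z k) i + appn U (N m) (lam m \- lam k.+1) i +
      appn U (N m) (lam k \- lam l) i = appn U (N m) (lam m \- lam l) i.
    by rewrite /z !appnB/=; ring.
  rewrite Ux0 addr0 => /eqP; rewrite eq_sym -subr_eq => /eqP <-.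
  set p := appn _ _ _ _; set q := appn _ _ _ _.
  by have := sqr_ge0 (p + q); nra.
rewrite mulrDr lerD2r -mulrA ler_wpM2l//.
(* The block lies below [N k.+1], where [U (lam_m - lam_(k+1))] is again pure perturbation. *)
apply: le_trans (galerkin_upper km (leqnn m)).
rewrite /sqsum -(big_mkord xpredT (fun i => appn U (N m) (lam m \- lam k.+1) i ^+ 2)).
rewrite (big_cat_nat (leq0n _) kk1)/= lerDr.
by apply: sumr_ge0 => i _; exact: sqr_ge0.
Qed.

Lemma sum_blocks (F : nat -> R) l m : (l <= m)%N ->
  \sum_(l <= k < m) \sum_(N k <= i < N k.+1) F i = \sum_(N l <= i < N m) F i.
Proof.
move=> lm; rewrite -(subnKC lm); elim: (m - l)%N => [|n IHn].
  by rewrite addn0 !big_geq.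
by rewrite addnS big_nat_recr ?leq_addr//= IHn -big_cat_nat//= leN// leq_addr.
Qed.

(** The vector does not change with [k] and the blocks are disjoint, so the norm of [U] is paid
    once, whatever the number of summands. *)
Lemma sum_upper_blocks l m : (l <= m)%N ->
  \sum_(l <= k < m) \sum_(N k <= i < N k.+1) appn U (N m) (lam m \- lam l) i ^+ 2
    <= cU ^+ 2 * sqsum (N m) (lam m \- lam l).
Proof.
move=> lm; rewrite sum_blocks//.
have supp_lam : suppn (N m) (lam m \- lam l).
  by apply: suppnB => //; exact: lam_suppn.
apply: le_trans (infmx_norm_finite (N m) U_norm supp_lam).
rewrite /sqsum -(big_mkord xpredT (fun i => appn U (N m) (lam m \- lam l) i ^+ 2)).
rewrite [X in _ <= X](big_cat_nat (leq0n _) (leN lm))/= lerDr.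
by apply: sumr_ge0 => i _; exact: sqr_ge0.
Qed.

End UpperIncrements.

(** * Riesz basis estimates between vectors of [V] and their coefficients *)

Section GalerkinCoefficients.
Context {R : realType} {V : completeNormedModType R}.
Set Implicit Arguments.
Unset Strict Implicit.
Context (a : {biscalar V}) (w : nat -> V) (C K : R) (hC : 0 < C).
Context (hwC : forall (x : V) (c : nat -> R), expansion w c x ->
    ((C^-1 * `|x| ^+ 2)%:E <= \sum_(0 <= n <oo) (c n ^+ 2)%:E)%E /\
    (\sum_(0 <= n <oo) (c n ^+ 2)%:E <= (C * `|x| ^+ 2)%:E)%E).
Context (hK : forall x v, `|a x v| <= K * `|x| * `|v|).

Lemma norm_lincomb n (c : nat -> R) :
  `|\sum_(i < n) c i *: w i| ^+ 2 <= C * sqsum n c.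
Proof.
have [x x0 xc] := suppn_extension (fun i : 'I_n => c i).
have -> : \sum_(i < n) c i *: w i = \sum_(i < n) x i *: w i.
  by apply: eq_bigr => i _; rewrite xc.
have -> : sqsum n c = sqsum n x by apply: eq_bigr => i _; rewrite xc.
have /hwC[+ _] : expansion w x (\sum_(i < n) x i *: w i).
  by apply: (@cvg_series_finite _ _ n (fun i => x i *: w i)) => k /x0->; rewrite scale0r.
by rewrite (sqsum_nneseries x0) lee_fin ler_pdivrMl.
Qed.

(** Duality: with [v] the combination of the [w i] with coefficients [a y (w i)], the sum [s] equals
    [a y v], whence [s^2 <= K^2 |y|^2 C s]; then divide by [s]. *)
Lemma sqsum_form n y : sqsum n (fun i => a y (w i)) <= K ^+ 2 * C * `|y| ^+ 2.
Proof.
set s := sqsum _ _; have s0 : 0 <= s by exact: sqsum_ge0.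
pose v := \sum_(i < n) a y (w i) *: w i.
have sE : s = a y v.
  rewrite linear_sumr; apply: eq_bigr => i _.
  by rewrite linearZr_LR/= expr2.
have v_le : `|v| ^+ 2 <= C * s := norm_lincomb n _.
have {}sE : s ^+ 2 <= K ^+ 2 * `|y| ^+ 2 * (C * s).
  apply: (@le_trans _ _ (K ^+ 2 * `|y| ^+ 2 * `|v| ^+ 2)).
    (* Taking roots leaves an absolute value on the right, as the sign of [K] is not known. *)
    rewrite -!exprMn -ler_sqrt ?sqr_ge0// !sqrtr_sqr ger0_norm//.
    by rewrite {1}sE (le_trans (ler_norm _))// (le_trans (hK _ _))// ler_norm.
  by rewrite ler_wpM2l// mulr_ge0// sqr_ge0.
have [->|sn0] := eqVneq s 0; first by rewrite mulr_ge0 ?sqr_ge0// mulr_ge0 ?sqr_ge0// ltW.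
by rewrite -(@ler_pM2r _ s) ?lt_def ?sn0//; apply: le_trans sE _; lra.
Qed.

Lemma appn_gram n (x : nat -> R) i :
  appn (gram a w) n x i = a (\sum_(j < n) x j *: w j) (w i).
Proof.
rewrite linear_sumlz; apply: eq_bigr => j _.
by rewrite linearZl_LR/= mulrC.
Qed.

End GalerkinCoefficients.

(** * Galerkin stability and the summed estimate with [eps^2] *)

Section QuasiOrthogonality.
Context {R : realType} {V : completeNormedModType R}.
Set Implicit Arguments.
Unset Strict Implicit.
Context (a : {biscalar V}) (w : nat -> V) (C K : R) (hC : 0 < C).
Context (hwC : forall (x : V) (c : nat -> R), expansion w c x ->
    ((C^-1 * `|x| ^+ 2)%:E <= \sum_(0 <= n <oo) (c n ^+ 2)%:E)%E /\
    (\sum_(0 <= n <oo) (c n ^+ 2)%:E <= (C * `|x| ^+ 2)%:E)%E).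
Context (hK : forall x v, `|a x v| <= K * `|x| * `|v|).
Context (N : nat -> nat) (hN0 : (0 < N 0%N)%N) (hN : forall k, (N k < N k.+1)%N).
Context (Cis : R) (M_infsup : mx_infsup (block_start N) (gram a w) Cis).
Context (f : {scalar V}) (u : V) (hu : forall v, a u v = f v).
Context (lam : nat -> nat -> R) (lam_supp : forall k, suppn (N k) (lam k)).

Let ul k := \sum_(i < N k) lam k i *: w i.
Let y k k' := lam k' \- lam k.

Context (hul : forall k i, (i < N k)%N -> a (ul k) (w i) = f (w i)).

Lemma sub_ulE k k' m : (k <= m)%N -> (k' <= m)%N ->
  ul k' - ul k = \sum_(i < N m) y k k' i *: w i.
Proof.
move=> km k'm; have ulE q : (q <= m)%N -> ul q = \sum_(i < N m) lam q i *: w i.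
  move=> qm; rewrite [RHS](@sum_widen _ (N q) _ (fun i => lam q i *: w i)) ?leN// => i qi.
  by rewrite lam_supp// scale0r.
rewrite !ulE// -sumrB; apply: eq_bigr => i _.
by rewrite -scalerBl.
Qed.

Lemma galerkin_orthogonality k k' m i : (k <= k')%N -> (k' <= m)%N -> (i < N k)%N ->
  appn (gram a w) (N m) (y k k') i = 0.
Proof.
move=> kk' k'm ik; rewrite appn_gram -sub_ulE ?(leq_trans kk')// linearBl /=.
by rewrite !hul ?subrr// (leq_trans ik)// leN.
Qed.

Let G := Cis ^+ 2 * (K ^+ 2 * C).

(** Against [w i] with [i < N m], [ul m] may be replaced by [u], so [M] maps the coefficient
    difference to the residual of [ul k]. The constant is independent of [m]. *)
Lemma galerkin_stability k m : (k <= m)%N ->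
  sqsum (N m) (y k m) <= G * `|u - ul k| ^+ 2.
Proof.
move=> km; apply: le_trans (mx_infsup_lead (k := m.+1) (y k m) M_infsup _) _ => //.
rewrite /G -mulrA ler_wpM2l ?sqr_ge0//=.
suff -> : sqsum (N m) (appn (gram a w) (N m) (y k m)) =
    sqsum (N m) (fun i => a (u - ul k) (w i)) by exact: sqsum_form.
apply: eq_bigr => i _; congr (_ ^+ 2).
by rewrite appn_gram -sub_ulE// !linearBl/= hu hul.
Qed.

Lemma increment_norm k : `|ul k.+1 - ul k| ^+ 2 <= C * sqsum (N k.+1) (y k k.+1).
Proof. by rewrite (@sub_ulE k k.+1 k.+1)//; exact: norm_lincomb. Qed.

Lemma quasi_optimality k : `|ul k.+1 - ul k| ^+ 2 <= C * G * `|u - ul k| ^+ 2.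
Proof.
apply: le_trans (increment_norm _) _.
by rewrite -mulrA ler_wpM2l ?(ltW hC)// galerkin_stability.
Qed.

Context (A L U Uinv : infmx R) (cU cUinv eps : R).
Context (A_infsup : mx_infsup (block_start N) A Cis)
  (MA : (infmx_norm (infmx_sub (gram a w) A) <= eps%:E)%E)
  (LU : block_LU (block_start N) A L U)
  (UUinv : infmx_inverse U Uinv)
  (U_norm : (infmx_norm U <= cU%:E)%E)
  (Uinv_norm : (infmx_norm Uinv <= cUinv%:E)%E).

Lemma quasi_orthogonality_sqr l m : (l <= m)%N ->
  \sum_(l <= k < m) `|ul k.+1 - ul k| ^+ 2 <=
    C * cUinv ^+ 2 * (9 * (cU ^+ 2 * Cis ^+ 2) * G) * eps ^+ 2 *
      (\sum_(l <= k < m) `|u - ul k| ^+ 2) +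
    C * cUinv ^+ 2 * (2 * cU ^+ 2 * G) * `|u - ul l| ^+ 2.
Proof.
move=> lm; pose K' := cU ^+ 2 * Cis ^+ 2 * eps ^+ 2.
pose S k := \sum_(N k <= i < N k.+1) appn U (N m) (y l m) i ^+ 2.
have K'0 : 0 <= K' by rewrite /K' -!exprMn sqr_ge0.
have step k : (l <= k)%N -> (k < m)%N ->
    `|ul k.+1 - ul k| ^+ 2 <=
    C * cUinv ^+ 2 * (9 * (K' * (G * `|u - ul k| ^+ 2)) + 2 * S k).
  move=> lk km; apply: le_trans (increment_norm _) _.
  rewrite -mulrA ler_wpM2l ?(ltW hC)//.
  apply: le_trans (increment_bound hN0 hN A_infsup MA LU UUinv U_norm Uinv_norm
    lam_supp galerkin_orthogonality lk km) _.
  rewrite ler_wpM2l ?sqr_ge0// -/(y _ _) -/(y _ _) -/(y _ _) -/(S _) -/K'.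
  have z_le := galerkin_stability (leqnSn k).
  (* Going through level [k] keeps the error at level [k.+1] out of the sum; the constant is
     [4 = 2 * (1 + 1)]. *)
  have : sqsum (N m) (y k.+1 m) <= 4 * (G * `|u - ul k| ^+ 2).
    have -> : y k.+1 m = y k m \- y k k.+1 by apply/funext => i; rewrite /y/=; ring.
    apply: le_trans (sqsumB _ _ _) _.
    rewrite (@sqsum_supp _ (N k.+1) (N m) (y k k.+1)) ?leN//; last first.
      by apply: suppnB => //; exact: lam_suppn.
    by have := galerkin_stability (ltnW km); lra.
  (* The factor 9 arises as [1 + 2 * 4]. *)
  move: z_le => /(ler_wpM2l K'0) h1 /(ler_wpM2l K'0) h2; lra.
apply: (@le_trans _ _ (\sum_(l <= k < m)
    C * cUinv ^+ 2 * (9 * (K' * (G * `|u - ul k| ^+ 2)) + 2 * S k))).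
  by rewrite !big_nat; apply: ler_sum => k /andP[]; exact: step.
rewrite -mulr_sumr big_split/= -!mulr_sumr.
have S_le : \sum_(l <= k < m) S k <= cU ^+ 2 * (G * `|u - ul l| ^+ 2).
  apply: le_trans (sum_upper_blocks hN U_norm lam_supp lm) _.
  by rewrite ler_wpM2l ?sqr_ge0// galerkin_stability.
apply: (@le_trans _ _ (C * cUinv ^+ 2 * (9 * (K' * (G * \sum_(l <= k < m) `|u - ul k| ^+ 2)) +
    2 * (cU ^+ 2 * (G * `|u - ul l| ^+ 2))))).
  have c0 : 0 <= C * cUinv ^+ 2 by rewrite mulr_ge0 ?sqr_ge0 ?(ltW hC).
  by rewrite (ler_wpM2l c0)// lerD2l ler_wpM2l.
by rewrite le_eqVlt; apply/orP; left; apply/eqP; rewrite /K'; ring.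
Qed.

End QuasiOrthogonality.

Theorem theorem3p2 (R : realType) (V : completeNormedModType R)
  (ip : {dot V for idfun}) (hV : is_hilbert ip)
  (a : {biscalar V}) (ha : bounded_form a)
  (ha_infsup : (0 < infsup a setT)%E)
  (w : nat -> V) (hw : riesz_basis ip w)
  (C : R) (hC : 0 < C)
  (hwC : forall (x : V) (c : nat -> R), expansion w c x ->
     ((C^-1 * `|x| ^+ 2)%:E <= \sum_(0 <= n <oo) (c n ^+ 2)%:E)%E /\
     (\sum_(0 <= n <oo) (c n ^+ 2)%:E <= (C * `|x| ^+ 2)%:E)%E)
  (Cis cU cUinv : R) :
  exists2 Cqo : R, 0 < Cqo &
  forall (N : nat -> nat) (X : nat -> set V)
    (hN0 : (0 < N 0%N)%N) (hN : forall l, (N l < N l.+1)%N)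
    (hX : forall l, X l = lin_span w (N l))
    (hX_infsup : (0 < ereal_inf [set infsup a (X l) | l in [set: nat]])%E)
    (eps : R) (heps : 0 < eps)
    (Meps : infmx R)
    (hMeps : (infmx_norm (infmx_sub (gram a w) Meps) <= eps%:E)%E)
    (hM_infsup : mx_infsup (block_start N) (gram a w) Cis)
    (hMeps_infsup : mx_infsup (block_start N) Meps Cis)
    (L U Uinv : infmx R)
    (hLU : block_LU (block_start N) Meps L U)
    (hUinv : infmx_inverse U Uinv)
    (hU_norm : infmx_norm U = cU%:E)
    (hUinv_norm : infmx_norm Uinv = cUinv%:E)
    (f : {scalar V}) (hf : continuous f)
    (u : V) (hu : galerkin_solution a f setT u)
    (ul : nat -> V) (hul : forall l, galerkin_solution a f (X l) (ul l))
    (l n : nat),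
    \sum_(l <= k < (l + n).+1)
       (`|ul k.+1 - ul k| ^+ 2 - Cqo * eps * `|u - ul k| ^+ 2)
      <= Cqo * `|u - ul l| ^+ 2.
Proof.
have [K hK] := ha.
pose G := Cis ^+ 2 * (K ^+ 2 * C).
pose c1 := C * cUinv ^+ 2 * (9 * (cU ^+ 2 * Cis ^+ 2) * G).
pose c2 := C * cUinv ^+ 2 * (2 * cU ^+ 2 * G).
have C0 := ltW hC.
have G0 : 0 <= G by do !(exact: sqr_ge0 || exact: C0 || apply: mulr_ge0).
have c10 : 0 <= c1.
  by do !(exact: sqr_ge0 || exact: C0 || exact: G0 || exact: ler0n || apply: mulr_ge0).
have c20 : 0 <= c2.
  by do !(exact: sqr_ge0 || exact: C0 || exact: G0 || exact: ler0n || apply: mulr_ge0).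
have CG0 : 0 <= C * G by exact: mulr_ge0.
(* The 1 gives positivity, [C * G] serves [eps > 1], and [c1], [c2] serve [eps <= 1]. Fixing the sum
   before [N], [eps] and the matrices are introduced yields the claimed dependence. *)
exists (1 + C * G + c1 + c2); first by rewrite -!addrA ltr_pwDl// !addr_ge0.
set Cqo := 1 + _ + _ + _.
move=> N X hN0 hN hX _ eps heps Meps hMeps hM_infsup hMeps_infsup L U Uinv hLU
  hUinv hU_norm hUinv_norm f _ u [_ hu] ul hul l n.
have /choice[lam lamP] : forall k, exists x : nat -> R,
    suppn (N k) x /\ ul k = \sum_(i < N k) x i *: w i.
  move=> k; have [+ _] := hul k; rewrite hX => -[c ->].
  have [x x0 xc] := suppn_extension c; exists x; split=> //.
  by apply: eq_bigr => i _; rewrite xc.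
have lam_supp k : suppn (N k) (lam k) by have [] := lamP k.
have ulE k : ul k = \sum_(i < N k) lam k i *: w i by have [] := lamP k.
have {}hu v : a u v = f v by exact: hu.
have {}hul k i : (i < N k)%N -> a (\sum_(j < N k) lam k j *: w j) (w i) = f (w i).
  move=> ik; rewrite -ulE; apply: (hul k).2; rewrite hX.
  exists (fun j => (j == Ordinal ik)%:R).
  rewrite (bigD1 (Ordinal ik))//= eqxx scale1r big1 ?addr0// => j /negbTE->.
  by rewrite scale0r.
have D0 k : 0 <= `|u - ul k| ^+ 2 by exact: sqr_ge0.
rewrite sumrB -mulr_sumr lerBlDr.
set D := \sum_(l <= k < _) `|u - ul k| ^+ 2.
have D_ge0 : 0 <= D by apply: sumr_ge0.
(* For [eps <= 1], [eps^2 <= eps] turns the quadratic estimate into the linear one. *)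
have [eps1|/ltW eps1] := leP eps 1.
  have lm : (l <= (l + n).+1)%N by rewrite -addnS leq_addr.
  have U_le : (infmx_norm U <= cU%:E)%E by rewrite hU_norm.
  have Uinv_le : (infmx_norm Uinv <= cUinv%:E)%E by rewrite hUinv_norm.
  have := quasi_orthogonality_sqr hC hwC hK hN0 hN hM_infsup hu lam_supp hul
    hMeps_infsup hMeps hLU hUinv U_le Uinv_le lm.
  rewrite -/G -/c1 -/c2.
  under eq_bigr do rewrite -!ulE.
  under [in X in _ <= X + _]eq_bigr do rewrite -!ulE.
  rewrite -ulE -/D => /le_trans; apply; rewrite addrC; apply: lerD.
    by rewrite ler_wpM2r// /Cqo; lra.
  rewrite ler_wpM2r// expr2 mulrA ler_wpM2r ?(ltW heps)//.
  apply: (@le_trans _ _ c1); last by rewrite /Cqo; lra.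
  by rewrite ler_piMr.
(* For [eps > 1] every summand is already absorbed, because [C * G <= Cqo <= Cqo * eps]. *)
have step k : `|ul k.+1 - ul k| ^+ 2 <= C * G * `|u - ul k| ^+ 2.
  by have := quasi_optimality hC hwC hK hN hM_infsup hu lam_supp hul k; rewrite -!ulE.
apply: (@le_trans _ _ (C * G * D)).
  by rewrite mulr_sumr; apply: ler_sum => k _; exact: step.
have Cqo0 : 0 <= Cqo by rewrite /Cqo; lra.
rewrite ler_wpDl ?mulr_ge0// ler_wpM2r//.
apply: (@le_trans _ _ Cqo); first by rewrite /Cqo; lra.
by rewrite ler_peMr.
Qed.
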